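(* Let $\mathbb{F}=\mathbb{F}_q$ be the field with $q$ elements, $V=\mathbb{F}^n$ with $n\ge 1$, and let $G\le \mathrm{GL}_n(\mathbb{F})$ be a subgroup. Let $V=W_1\sqcup\cdots\sqcup W_k$ be the decomposition of $V$ into its $k$ distinct $G$-orbits, let $\gamma=\lceil \log_q(k)\rceil$, and let $f_1,\ldots,f_k\in\mathbb{F}[V]$ be the polynomials defined in the context. Let $(a_{ij})\in\mathbb{F}^{\gamma\times k}$ be a matrix all of whose columns are pairwise different. (a) If $G$ is a subgroup of the group $G_n$ of monomial matrices, then the elements $$t'_i=a_{i1}f_1+\cdots+a_{ik}f_k\qquad(1\le i\le\gamma)$$ form a minimal separating set for $\mathbb{F}[V]^G$ (a separating set with the smallest possible number of elements) consisting of invariants of degree less than or equal to $n(q-1)$. (b) If $|G|$ is invertible in $\mathbb{F}$, then, with $h_j=\frac{1}{|G|}\sum_{g\in G}g\cdot f_j$ for $1\le j\le k$, the elements $$t''_i=a_{i1}h_1+\cdots+a_{ik}h_k\qquad(1\le i\le\gamma)$$ form a minimal separating set for $\mathbb{F}[V]^G$ (a separating set with the smallest possible number of elements) consisting of invariants of degree less than or equal to $n(q-1)$.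
   Context: $\mathbb{F}[V]=\mathbb{F}[x_1,\ldots,x_n]$ is the polynomial ring (as formal polynomials), with $x_1,\ldots,x_n$ the coordinate functions on $V=\mathbb{F}^n$. The group $G$ acts on $\mathbb{F}[V]$ by $\mathbb{F}$-algebra automorphisms, determined on linear forms $f\in V^*$ by $(g\cdot f)(v)=f(g^{-1}v)$. $\mathbb{F}[V]^G=\{f\in\mathbb{F}[V]\mid g\cdot f=f\text{ for all }g\in G\}$. Elements $u,v\in V$ are separated by a set $S\subset\mathbb{F}[V]^G$ if $f(u)\ne f(v)$ for some $f\in S$. A subset $S\subset\mathbb{F}[V]^G$ is called separating for $\mathbb{F}[V]^G$ if any $u,v\in V$ that can be separated by $\mathbb{F}[V]^G$ can also be separated by $S$. $G_n<\mathrm{GL}_n(\mathbb{F})$ denotes the group of monomial matrices, i.e. $n\times n$ matrices over $\mathbb{F}$ with exactly one nonzero entry in each row and exactly one nonzero entry in each column. For $w=(w_1,\ldots,w_n)\in V$ define $$f_w=(-1)^n\prod_{i=1}^n\ \prod_{a\in\mathbb{F}\setminus\{w_i\}}(x_i-a)\in\mathbb{F}[V],$$ and for $1\le j\le k$ define $f_j=\sum_{w\in W_j}f_w$. *)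

(* Defs.v *)
From mathcomp Require Import all_boot all_order all_algebra all_fingroup.
From mathcomp Require Import finmap.
From mathcomp.multinomials Require Import mpoly.

Set Implicit Arguments.
Unset Strict Implicit.
Unset Printing Implicit Defensive.

Import GRing.Theory.

Local Open Scope ring_scope.

(* Throughout, the dimension of V is n.+1, and V is the space of column       *)
(* vectors, on which matrices act by left multiplication.                     *)

(* The algebra endomorphism with 'X_i |-> 'X_i \o g^-1, that is,              *)
(* 'X_i |-> \sum_j (g^-1) i j *: 'X_j.                                        *)
Definition mpoly_act (F : finFieldType) (n : nat) (g : {'GL_n.+1[F]})
    (f : {mpoly F[n.+1]}) : {mpoly F[n.+1]} :=
  f \mPo [tuple \sum_(j < n.+1) GLval (g^-1)%g i j *: 'X_j | i < n.+1].

Definition Ginvariant (F : finFieldType) (n : nat) (G : {group {'GL_n.+1[F]}})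
    (f : {mpoly F[n.+1]}) : Prop :=
  forall g, g \in G -> mpoly_act g f = f.

Definition evalV (F : finFieldType) (n : nat) (f : {mpoly F[n.+1]})
    (v : 'cV[F]_n.+1) : F :=
  f.@[fun i => v i 0].

Definition separated_by (F : finFieldType) (n : nat)
    (S : {mpoly F[n.+1]} -> Prop) (u v : 'cV[F]_n.+1) : Prop :=
  exists2 f, S f & evalV f u <> evalV f v.

Definition separating (F : finFieldType) (n : nat)
    (G : {group {'GL_n.+1[F]}}) (S : {mpoly F[n.+1]} -> Prop) : Prop :=
  (forall f, S f -> Ginvariant G f) /\
  (forall u v, separated_by (Ginvariant G) u v -> separated_by S u v).

(* Minimality refers to cardinality, not to inclusion. *)
Definition minimal_separating (F : finFieldType) (n : nat)
    (G : {group {'GL_n.+1[F]}}) (S : {fset {mpoly F[n.+1]}}) : Prop :=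
  separating G (fun f => f \in S) /\
  (forall S' : {fset {mpoly F[n.+1]}},
     separating G (fun f => f \in S') -> (#|` S| <= #|` S'|)%N).

Definition Gorbit (F : finFieldType) (n : nat) (G : {group {'GL_n.+1[F]}})
    (v : 'cV[F]_n.+1) : {set 'cV[F]_n.+1} :=
  [set GLval g *m v | g : {'GL_n.+1[F]} in G].

(* W lists each orbit of G on V exactly once. *)
Definition orbit_decomposition (F : finFieldType) (n : nat)
    (G : {group {'GL_n.+1[F]}}) (k : nat)
    (W : 'I_k -> {set 'cV[F]_n.+1}) : Prop :=
  injective W /\
  [set W j | j : 'I_k] = [set Gorbit G v | v : 'cV[F]_n.+1].

Definition monomial_group (F : finFieldType) (n : nat) :
    {set {'GL_n.+1[F]}} :=
  [set g : {'GL_n.+1[F]} |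
    [forall i, #|[set j | GLval g i j != 0]| == 1%N] &&
    [forall j, #|[set i | GLval g i j != 0]| == 1%N]].

Definition fpt (F : finFieldType) (n : nat) (w : 'cV[F]_n.+1) :
    {mpoly F[n.+1]} :=
  (-1) ^+ n.+1 *
  \prod_(i < n.+1) \prod_(a : F | a != w i 0) ('X_i - a%:MP).

Definition forb (F : finFieldType) (n k : nat)
    (W : 'I_k -> {set 'cV[F]_n.+1}) (j : 'I_k) : {mpoly F[n.+1]} :=
  \sum_(w in W j) fpt w.

Definition havg (F : finFieldType) (n k : nat) (G : {group {'GL_n.+1[F]}})
    (W : 'I_k -> {set 'cV[F]_n.+1}) (j : 'I_k) : {mpoly F[n.+1]} :=
  (#|G|%:R)^-1 *: \sum_(g in G) mpoly_act g (forb W j).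

Definition combination (F : finFieldType) (n m k : nat) (a : 'M[F]_(m, k))
    (p : 'I_k -> {mpoly F[n.+1]}) (i : 'I_m) : {mpoly F[n.+1]} :=
  \sum_(j < k) a i j *: p j.

(* For p != 0, msize p is one more than the total degree of p. *)
Definition total_degree (F : finFieldType) (n : nat)
    (p : {mpoly F[n.+1]}) : nat := (msize p).-1.

(* Main.v *)
(* Wilson's theorem makes fpt w the indicator function of the point w, so     *)
(* forb W j, and in the nonmodular case havg G W j, are indicators of the     *)
(* orbit W j. Hence combination a p i takes the value a i j on W j, and the   *)
(* values on distinct orbits differ because the columns of a do. Conversely,  *)
(* a separating set S embeds the k orbits into F ^ S, so k <= q ^ #|S|.       *)
(* A monomial matrix g maps 'X_(s i) to a multiple c^-1 *: 'X_i, and          *)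
(* c ^+ (q - 1) = 1 turns this into the identity of formal polynomials        *)
(* mpoly_act g (fpt w) = fpt (g *m w), which gives invariance in part (a).    *)

From HB Require Import structures.
Require Import Defs.
From mathcomp Require Import all_boot all_order all_algebra all_fingroup.
From mathcomp Require Import finmap finfield.
From mathcomp.multinomials Require Import mpoly.

Set Implicit Arguments.
Unset Strict Implicit.
Unset Printing Implicit Defensive.

Import GRing.Theory.

Local Open Scope ring_scope.

(** An invariant is constant on orbits, so the question is how few functions tell the k orbits
    apart. Suppose formal invariants [p j] take the value 1 on [W j] and 0 elsewhere. The values of
    the combinations on [W j] then form column j of [a], so distinct columns separate distinct
    orbits ([combination_separates]). Hence every separating set S must also separate all orbits.
    Its values inject the orbits into F^S, which gives the lower bound [up_log #|F| k]
    ([separating_lower_bound]), and the combinations attain it. It remains to supply such [p].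
    [evalV_forb] and [evalV_havg] give the values. Invariance must hold for formal polynomials, not
    just for functions: it comes from [fpt_act_monomial] in the monomial case and from averaging
    over G in the other. Linear substitutions do not raise the degree ([total_degree_act]), so the
    bound for [fpt] carries over. *)

(** Translation reduces this Wilson identity to w = 0. There, cancel X in X^q - X = \prod_a (X - a)
    and evaluate at 0. *)
Lemma prod_sub_neq (F : finFieldType) (w : F) :
  \prod_(a : F | a != w) (w - a) = -1.
Proof.
transitivity (\prod_(a : F | a != 0) (0 - a)).
  rewrite (reindex_inj (addrI w)) /=; apply: eq_big => [a|a _].
    by rewrite -subr_eq0 addrC addKr.
  by rewrite opprD addrA subrr.
have q_gt0 : (0 < #|F|.-1)%N by rewrite -subn1 subn_gt0 finNzRing_gt1.
have genE : 'X * ('X^(#|F|.-1) - 1) = 'X * \prod_(a | a != 0) ('X - a%:P)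
    :> {poly F}.
  rewrite mulrBr mulr1 -exprS (ltn_predK (finNzRing_gt1 F)) finField_genPoly.
  by rewrite (bigD1 0) //= subr0.
have X_neq0 : 'X != 0 :> {poly F} by rewrite polyX_eq0.
move/(mulfI X_neq0)/(congr1 (horner^~ 0)): genE.
rewrite hornerD hornerN hornerXn hornerC expr0n eqn0Ngt q_gt0 sub0r => ->.
by rewrite horner_prod; apply: eq_bigr => a _; rewrite hornerXsubC.
Qed.

(** * The action on polynomials and the point indicators *)

Section Action.
Variables (F : finFieldType) (n : nat).
Implicit Types (g h : {'GL_n.+1[F]}) (p : {mpoly F[n.+1]}) (v w : 'cV[F]_n.+1).

HB.instance Definition _ g := GRing.LRMorphism.copy (mpoly_act g)
  (comp_mpoly [tuple \sum_(j < n.+1) GLval (g^-1)%g i j *: 'X_j | i < n.+1]).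

Lemma mpoly_actXU g i :
  mpoly_act g 'X_i = \sum_(j < n.+1) GLval (g^-1)%g i j *: 'X_j.
Proof. by rewrite /mpoly_act comp_mpolyXU -tnth_nth tnth_mktuple. Qed.

Lemma mpoly_actC g c : mpoly_act g c%:MP = c%:MP.
Proof. exact: comp_mpolyC. Qed.

(** Substitution reverses the order of matrix products and so does inversion, hence a left action.
    Expanding in monomials reduces the claim to the variables. *)
Lemma mpoly_actM g h p : mpoly_act (g * h)%g p = mpoly_act g (mpoly_act h p).
Proof.
rewrite {1}/mpoly_act invMg comp_mpolyEX.
rewrite {2}/mpoly_act comp_mpolyEX raddf_sum /=.
apply: eq_bigr => m _; rewrite linearZ !comp_mpolyX rmorph_prod /=.
congr (_ *: _); apply: eq_bigr => i _; rewrite rmorphXn; congr (_ ^+ _).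
rewrite !tnth_mktuple raddf_sum /=.
under [RHS]eq_bigr do rewrite linearZ /= mpoly_actXU scaler_sumr.
rewrite exchange_big /=; apply: eq_bigr => j _.
rewrite mxE scaler_suml.
by apply: eq_bigr => l _; rewrite scalerA.
Qed.

Lemma evalV_act g p v : evalV (mpoly_act g p) v = evalV p (GLval (g^-1)%g *m v).
Proof.
rewrite /evalV /mpoly_act comp_mpoly_meval; apply: meval_eq => i.
rewrite tnth_mktuple raddf_sum mxE; apply: eq_bigr => j _ /=.
by rewrite mevalZ mevalXU.
Qed.

Lemma evalV_fpt w v : evalV (fpt w) v = (v == w)%:R.
Proof.
rewrite /evalV /fpt rmorphM rmorphXn rmorphN1 rmorph_prod /=.
have [->|neq_vw] := eqVneq v w.
  rewrite (eq_bigr (fun=> -1)) => [|i _].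
    (* Each coordinate contributes -1, and the sign in [fpt] cancels these. *)
    by rewrite big_const_ord iter_mulr_1 -exprMn mulrNN mulr1 expr1n.
  rewrite rmorph_prod /= -[RHS](prod_sub_neq (w i 0)).
  by apply: eq_bigr => a _; rewrite mevalB mevalXU mevalC.
have /existsP [i neq_i] : [exists i, v i 0 != w i 0].
  apply: contraR neq_vw; rewrite negb_exists => /forallP eq_vw.
  by apply/eqP/colP => i; apply/eqP/negbNE/eq_vw.
(* At a coordinate where v and w differ, the factor with a = v_i vanishes. *)
rewrite (bigD1 i) //= rmorph_prod /= (bigD1 (v i 0)) //=.
by rewrite mevalB mevalXU mevalC subrr !mul0r mulr0.
Qed.

Lemma fpt_act_monomial g w :
  g \in monomial_group F n -> mpoly_act g (fpt w) = fpt (GLval g *m w).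
Proof.
rewrite inE => /andP [/forallP row_g /forallP col_g].
(* [s i] is the column of the only nonzero entry in row i; the column condition will make [s]
   injective. *)
have /fin_all_exists [s sP] i : exists j, [set j | GLval g i j != 0] = [set j].
  by apply/cards1P/row_g.
have g_off i j : j != s i -> GLval g i j = 0.
  move=> neq_j; have: j \notin [set s i] by rewrite inE.
  by rewrite -sP inE negbK => /eqP.
have g_on i : GLval g i (s i) != 0.
  by have := set11 (s i); rewrite -sP inE.
have s_inj : injective s.
  move=> i1 i2 eq_s; have /cards1P [i colE] := col_g (s i1).
  have /set1P -> : i1 \in [set i] by rewrite -colE inE g_on.
  by have /set1P -> : i2 \in [set i] by rewrite -colE inE eq_s g_on.
have g_mul m (B : 'M_(n.+1, m)) i j :
    (GLval g *m B) i j = GLval g i (s i) * B (s i) j.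
  rewrite mxE (bigD1 (s i)) //= big1 ?addr0 // => l neq_l.
  by rewrite g_off ?mul0r.
have actX i : mpoly_act g 'X_(s i) = (GLval g i (s i))^-1 *: 'X_i.
  have gV j : GLval (g^-1)%g (s i) j = (GLval g i (s i))^-1 * (i == j)%:R.
    have := g_mul _ (GLval (g^-1)%g) i j.
    rewrite -GL_MxE mulgV mxE => ->.
    by rewrite mulKf.
  rewrite mpoly_actXU (bigD1 i) //= gV eqxx mulr1 big1 ?addr0 // => j neq_j.
  by rewrite gV eq_sym (negPf neq_j) mulr0 scale0r.
rewrite /fpt rmorphM rmorphXn rmorphN1; congr (_ * _).
rewrite rmorph_prod (reindex_inj s_inj) /=; apply: eq_bigr => i _.
rewrite rmorph_prod g_mul /=; set c := GLval g i (s i).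
have c_neq0 : c != 0 by apply: g_on.
(* Replacing a by c * a turns the excluded value c * w_(s i) into w_(s i), so both products run over
   the same a. *)
rewrite [RHS](reindex_inj (mulfI c_neq0)) /=.
rewrite [RHS](eq_bigl (fun a => a != w (s i) 0)); last first.
  by move=> a; rewrite (inj_eq (mulfI c_neq0)).
have expc : c ^+ #|F|.-1 = 1.
  apply: (mulfI c_neq0); rewrite -exprS (ltn_predK (finNzRing_gt1 F)) mulr1.
  exact: expf_card.
(* There are q - 1 linear factors: writing 1 as c^(q-1) gives each its own c, and c * (c^-1 X_i - a)
   = X_i - c * a. *)
rewrite -[LHS]scale1r -expc -(cardC1 (w (s i) 0)).
rewrite -[LHS]mul_mpolyC rmorphXn -prodr_const -big_split /=.
apply: eq_bigr => a _; rewrite raddfB /= mpoly_actC actX -/c.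
by rewrite mul_mpolyC scalerBr scalerA divff // scale1r -mul_mpolyC -mpolyCM.
Qed.

(** * Bounds on the total degree *)

Lemma total_degreeM p q :
  (total_degree (p * q) <= total_degree p + total_degree q)%N.
Proof.
have [->|p_neq0] := eqVneq p 0; first by rewrite mul0r /total_degree msize0.
have [->|q_neq0] := eqVneq q 0; first by rewrite mulr0 /total_degree msize0.
rewrite /total_degree msizeM //.
by case: (msize p) (msize q) => [|d] [|e]; rewrite ?addnS ?addn0 /= ?leq_pred.
Qed.

Lemma total_degree_prod (I : Type) (r : seq I) (P : pred I)
    (f : I -> {mpoly F[n.+1]}) :
  (total_degree (\prod_(i <- r | P i) f i)
     <= \sum_(i <- r | P i) total_degree (f i))%N.
Proof.
elim/big_ind2: _ => [|p1 d1 p2 d2 le1 le2|//].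
  by rewrite /total_degree msize1.
exact: leq_trans (total_degreeM _ _) (leq_add le1 le2).
Qed.

Lemma total_degree_sum (I : Type) (r : seq I) (P : pred I)
    (f : I -> {mpoly F[n.+1]}) d :
  (forall i, P i -> (total_degree (f i) <= d)%N) ->
  (total_degree (\sum_(i <- r | P i) f i) <= d)%N.
Proof.
move=> le_d; elim/big_ind: _ => [|p q lep leq|//].
  by rewrite /total_degree msize0.
rewrite /total_degree -subn1 leq_subLR add1n.
apply: leq_trans (msizeD_le _ _) _; rewrite geq_max.
by move: lep leq; rewrite /total_degree -!subn1 !leq_subLR !add1n => -> ->.
Qed.

Lemma total_degreeZ c p : (total_degree (c *: p) <= total_degree p)%N.
Proof. by rewrite /total_degree -!subn1 leq_sub2r ?msizeZ_le. Qed.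

Lemma total_degreeXU i : total_degree ('X_i : {mpoly F[n.+1]}) = 1%N.
Proof. by rewrite /total_degree msizeX mdeg1. Qed.

Lemma total_degree_act g p : (total_degree (mpoly_act g p) <= total_degree p)%N.
Proof.
rewrite /mpoly_act comp_mpolyEX big_seq; apply: total_degree_sum => m m_supp.
apply: leq_trans (total_degreeZ _ _) _; rewrite comp_mpolyX.
apply: leq_trans (total_degree_prod _ _ _) _.
have le_mp : (mdeg m <= total_degree p)%N.
  by rewrite /total_degree -ltnS (leq_trans (msize_mdeg_lt m_supp)) ?leqSpred.
apply: leq_trans le_mp; rewrite mdegE; apply: leq_sum => i _.
rewrite -(card_ord (m i)) -prodr_const.
apply: leq_trans (total_degree_prod _ _ _) _.
rewrite -sum1_card; apply: leq_sum => _ _.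
rewrite tnth_mktuple; apply: total_degree_sum => j _.
by apply: leq_trans (total_degreeZ _ _) _; rewrite total_degreeXU.
Qed.

Lemma total_degree_fpt w : (total_degree (fpt w) <= n.+1 * (#|F| - 1))%N.
Proof.
apply: leq_trans (total_degreeM _ _) _.
have -> : total_degree ((-1) ^+ n.+1 : {mpoly F[n.+1]}) = 0%N.
  by rewrite -mpolyC1 -mpolyCN -rmorphXn /total_degree msizeC; case: eqP.
apply: leq_trans (total_degree_prod _ _ _) _.
rewrite -[X in (_ <= X * _)%N](card_ord n.+1) -sum_nat_const.
apply: leq_sum => i _.
apply: leq_trans (total_degree_prod _ _ _) _.
rewrite subn1 -(cardC1 (w i 0)) -sum1_card; apply: leq_sum => a _.
rewrite -[X in (_ <= X)%N]/(2.-1) /total_degree -!subn1 leq_sub2r //.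
apply: leq_trans (msizeD_le _ _) _.
by rewrite geq_max msizeX mdeg1 msizeN msizeC; case: eqP.
Qed.


End Action.

(** * Orbits, separation and minimality *)

Section Orbits.
Variables (F : finFieldType) (n : nat) (G : {group {'GL_n.+1[F]}}).
Implicit Types (u v : 'cV[F]_n.+1).

Lemma Gorbit_refl v : v \in Gorbit G v.
Proof. by apply/imsetP; exists 1%g; rewrite ?group1 // mul1mx. Qed.

Lemma Gorbit_eq u v : u \in Gorbit G v -> Gorbit G u = Gorbit G v.
Proof.
case/imsetP => g gG ->; apply/setP => x; apply/imsetP/imsetP => -[h hG ->].
  by exists (h * g)%g; rewrite ?groupM // GL_MxE mulmxA.
exists (h * g^-1)%g; rewrite ?groupM ?groupV //.
by rewrite mulmxA -GL_MxE mulgKV.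
Qed.

Lemma Ginvariant_Gorbit p u v :
  Ginvariant G p -> Gorbit G u = Gorbit G v -> evalV p u = evalV p v.
Proof.
move=> p_inv eq_uv; have: u \in Gorbit G v by rewrite -eq_uv Gorbit_refl.
case/imsetP => g gG ->; rewrite -(p_inv g gG) evalV_act mulmxA -GL_MxE.
by rewrite mulVg mul1mx p_inv.
Qed.

Lemma Ginvariant_combination m k (a : 'M[F]_(m, k)) p i :
  (forall j, Ginvariant G (p j)) -> Ginvariant G (combination a p i).
Proof.
move=> p_inv g gG; rewrite /combination raddf_sum /=; apply: eq_bigr => j _.
by rewrite linearZ /= p_inv.
Qed.

Lemma total_degree_combination m k (a : 'M[F]_(m, k))
    (p : 'I_k -> {mpoly F[n.+1]}) i d :
  (forall j, (total_degree (p j) <= d)%N) ->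
  (total_degree (combination a p i) <= d)%N.
Proof.
move=> le_d; apply: total_degree_sum => j _.
exact: leq_trans (total_degreeZ _ _) (le_d j).
Qed.

Variables (k : nat) (W : 'I_k -> {set 'cV[F]_n.+1}).
Hypothesis hW : orbit_decomposition G W.

Lemma orbit_rep j : exists v, W j = Gorbit G v.
Proof.
have /imsetP [v _ ->] : W j \in [set Gorbit G v | v : 'cV[F]_n.+1].
  by rewrite -(proj2 hW) imset_f.
by exists v.
Qed.

Lemma orbit_index v : exists j, W j = Gorbit G v.
Proof.
have /imsetP [j _ ->] : Gorbit G v \in [set W j | j : 'I_k].
  by rewrite (proj2 hW) imset_f.
by exists j.
Qed.

Lemma orbit_mem j v : (v \in W j) = (W j == Gorbit G v).
Proof.
have [u ->] := orbit_rep j.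
apply/idP/eqP => [/Gorbit_eq -> //|->]; exact: Gorbit_refl.
Qed.

Lemma orbit_stable j g v : g \in G -> (GLval g *m v \in W j) = (v \in W j).
Proof.
move=> gG; rewrite !orbit_mem (@Gorbit_eq (GLval g *m v) v) //.
by apply/imsetP; exists g.
Qed.

Section Indicators.
Variables (m : nat) (a : 'M[F]_(m, k)) (p : 'I_k -> {mpoly F[n.+1]}).
Hypothesis p_inv : forall j, Ginvariant G (p j).
Hypothesis p_ind : forall j v, evalV (p j) v = (v \in W j)%:R.
Hypothesis ha : forall j1 j2 : 'I_k, j1 <> j2 -> col j1 a <> col j2 a.

Lemma evalV_combination i j v :
  v \in W j -> evalV (combination a p i) v = a i j.
Proof.
move=> vWj; rewrite /evalV /combination raddf_sum (bigD1 j) //= big1.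
  by rewrite addr0 mevalZ -/(evalV _ _) p_ind vWj mulr1.
move=> l neq_lj; rewrite mevalZ -/(evalV _ _) p_ind.
move: vWj; rewrite !orbit_mem => /eqP <-.
by rewrite (inj_eq (proj1 hW)) (negPf neq_lj) mulr0.
Qed.

Lemma combination_separates u v : Gorbit G u <> Gorbit G v ->
  exists i, evalV (combination a p i) u <> evalV (combination a p i) v.
Proof.
have [[ju uE] [jv vE]] := (orbit_index u, orbit_index v).
rewrite -uE -vE => neq_uv.
have /ha : ju <> jv by move=> eq_j; apply: neq_uv; rewrite eq_j.
have [/forallP eqa|] := boolP [forall i, a i ju == a i jv].
  by case; apply/colP => i; rewrite !mxE; apply/eqP.
rewrite negb_forall => /existsP [i /eqP neq_a] _; exists i.
rewrite (@evalV_combination i ju) ?orbit_mem ?uE //.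
by rewrite (@evalV_combination i jv) ?orbit_mem ?vE.
Qed.

Lemma combination_separating :
  separating G (fun f => f \in [fset combination a p i | i in 'I_m]%fset).
Proof.
split=> [f /imfsetP [i _ ->]|u v [f f_inv neq_f]].
  exact: Ginvariant_combination.
have [|i neq_i] := @combination_separates u v.
  by move=> eq_uv; apply: neq_f; apply: Ginvariant_Gorbit.
by exists (combination a p i) => //; apply/imfsetP; exists i.
Qed.

Lemma separating_lower_bound (S : {fset {mpoly F[n.+1]}}) :
  separating G (fun f => f \in S) -> (up_log #|F| k <= #|` S|)%N.
Proof.
move=> [S_inv S_sep]; apply: up_log_min; first exact: finNzRing_gt1.
have /fin_all_exists [r rE] := orbit_rep.
(* The values of all elements of S at a representative of orbit j; injectivity in j gives k <=
   q^|S|. *)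
pose val_at j := [ffun f : S => evalV (val f) (r j)].
have val_inj : injective val_at.
  move=> j1 j2 eq_val; apply/eqP; apply: contraT => /eqP neq_j.
  have [|i neq_i] := @combination_separates (r j1) (r j2).
    by rewrite -!rE => /(proj1 hW).
  (* The separating combination is itself an invariant, so S must separate the two representatives
     as well. *)
  have [|f fS []] := S_sep (r j1) (r j2).
    by exists (combination a p i) => //; apply: Ginvariant_combination.
  by have /ffunP /(_ [` fS]%fset) := eq_val; rewrite !ffunE.
by have := leq_card _ val_inj; rewrite card_ord card_ffun -cardfE.
Qed.

End Indicators.

Lemma minimal_separating_combination (a : 'M[F]_(up_log #|F| k, k)) p :
  (forall j, Ginvariant G (p j)) ->
  (forall j v, evalV (p j) v = (v \in W j)%:R) ->
  (forall j1 j2 : 'I_k, j1 <> j2 -> col j1 a <> col j2 a) ->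
  minimal_separating G
    [fset combination a p i | i in 'I_(up_log #|F| k)]%fset.
Proof.
move=> p_inv p_ind ha; split; first exact: combination_separating.
move=> S /(separating_lower_bound p_inv p_ind ha); apply: leq_trans.
(* An upper bound on the size of the image suffices; the lower bound rules out coincidences. *)
apply: leq_trans (leq_imfset_card _ _ _) _.
by rewrite -cardE card_ord.
Qed.

(** * The orbit sums and their averages as invariant indicators *)

Lemma evalV_forb j v : evalV (forb W j) v = (v \in W j)%:R.
Proof.
rewrite /evalV /forb raddf_sum /=.
under eq_bigr do rewrite -/(evalV _ _) evalV_fpt.
have [vW|vW] := boolP (v \in W j).
  rewrite (bigD1 v) //= eqxx big1 ?addr0 // => w /andP [_ neq_wv].
  by rewrite eq_sym (negPf neq_wv).
by rewrite big1 // => w wW; case: eqP vW => // ->; rewrite wW.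
Qed.

Lemma total_degree_forb j : (total_degree (forb W j) <= n.+1 * (#|F| - 1))%N.
Proof. by apply: total_degree_sum => w _; apply: total_degree_fpt. Qed.

(** A monomial g sends [fpt w] to [fpt (g w)], and w -> g w permutes the orbit, so the summands are
    only rearranged. *)
Lemma Ginvariant_forb j :
  G \subset monomial_group F n -> Ginvariant G (forb W j).
Proof.
move=> /subsetP G_mon g gG; rewrite /forb raddf_sum.
under eq_bigr do rewrite /= fpt_act_monomial ?G_mon //.
rewrite [RHS](reindex_inj (h := mulmx (GLval g))) /=; last first.
  apply: can_inj (mulmx (GLval g^-1)) _ => v.
  by rewrite mulmxA -GL_MxE mulVg mul1mx.
by apply: eq_bigl => v; rewrite orbit_stable.
Qed.

Lemma Ginvariant_havg j : Ginvariant G (havg G W j).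
Proof.
move=> g gG; rewrite /havg linearZ /=; congr (_ *: _); rewrite raddf_sum /=.
under eq_bigr do rewrite -mpoly_actM.
rewrite [RHS](reindex_inj (mulgI g)) /=.
by apply: eq_bigl => h; rewrite groupMl.
Qed.

(** Orbits are stable under G, so every translate of [forb W j] takes the same value at v and
    averaging changes no value. *)
Lemma evalV_havg j v :
  #|G|%:R != 0 :> F -> evalV (havg G W j) v = (v \in W j)%:R.
Proof.
move=> G_neq0; rewrite /evalV /havg mevalZ raddf_sum /=.
rewrite (eq_bigr (fun=> (v \in W j)%:R)) => [|g gG].
  by rewrite sumr_const -[X in _ * X]mulr_natl mulKf.
by rewrite -/(evalV _ _) evalV_act evalV_forb orbit_stable ?groupV.
Qed.

Lemma total_degree_havg j :
  (total_degree (havg G W j) <= n.+1 * (#|F| - 1))%N.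
Proof.
apply: leq_trans (total_degreeZ _ _) _; apply: total_degree_sum => g _.
exact: leq_trans (total_degree_act _ _) (total_degree_forb _).
Qed.

End Orbits.

Theorem theorem2p5 (F : finFieldType) (n : nat) (G : {group {'GL_n.+1[F]}})
    (k : nat) (W : 'I_k -> {set 'cV[F]_n.+1})
    (hW : orbit_decomposition G W)
    (a : 'M[F]_(up_log #|F| k, k))
    (ha : forall j1 j2 : 'I_k, j1 <> j2 -> col j1 a <> col j2 a) :
  (G \subset monomial_group F n ->
     minimal_separating G
       [fset combination a (forb W) i | i in 'I_(up_log #|F| k)]%fset /\
     (forall i : 'I_(up_log #|F| k),
        Ginvariant G (combination a (forb W) i) /\
        (total_degree (combination a (forb W) i) <= n.+1 * (#|F| - 1))%N)) /\
  (#|G|%:R \is a @GRing.unit F ->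
     minimal_separating G
       [fset combination a (havg G W) i | i in 'I_(up_log #|F| k)]%fset /\
     (forall i : 'I_(up_log #|F| k),
        Ginvariant G (combination a (havg G W) i) /\
        (total_degree (combination a (havg G W) i) <= n.+1 * (#|F| - 1))%N)).
Proof.
split=> [G_mon|G_unit].
  have f_inv j := Ginvariant_forb hW j G_mon.
  split; first exact: (minimal_separating_combination hW f_inv (evalV_forb W)).
  move=> i; split; first exact: Ginvariant_combination.
  by apply: total_degree_combination => j; apply: total_degree_forb.
have h_inv := Ginvariant_havg (G := G) W.
have h_ind j v : evalV (havg G W j) v = (v \in W j)%:R.
  by apply: evalV_havg; rewrite // -unitfE.
split; first exact: (minimal_separating_combination hW h_inv h_ind).
move=> i; split; first exact: Ginvariant_combination.
by apply: total_degree_combination => j; apply: total_degree_havg.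
Qed.
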